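(* Let $\varphi,\varphi_1,\varphi_2\in H^1[0,1]$ and $f\in H_0^1[0,1]$ satisfy $\varphi(0)=0$, $\varphi(1)=1$, $\varphi_1(1)=1$, $\varphi_2(0)=0$, and $0\le\varphi(x)\le 1$, $0\le\varphi_1(x)\le 1$, $0\le\varphi_2(x)\le 1$ for all $x\in[0,1]$. Let $m\ge 1$ be an integer and suppose that $\varphi_1,\varphi_2\in C^m[0,1]$ and $\varphi,f\in C^{m+1}[0,1]$. Additionally, assume that $(1+\|\varphi\|)(\|\varphi_1\|+\|\varphi_2\|)<1$. Then the (unique) solution $u\in H_0^1[0,1]$ of $$u(x)=\varphi(x)\,u(\varphi_1(x))+(1-\varphi(x))\,u(\varphi_2(x))+f(x)\quad\text{for all }x\in[0,1],\qquad u(0)=u(1)=0,$$ belongs to $C^m[0,1]$.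
   Context: $H^1[0,1]$ denotes the space of Lipschitz functions: all $v\in C[0,1]$ (real-valued continuous functions on $[0,1]$) with $\|v\|:=\sup_{x,y\in[0,1],\,x\ne y}\frac{|v(x)-v(y)|}{|x-y|}<\infty$. (This is not a Sobolev space.) For any $v\in H^1[0,1]$ the symbol $\|v\|$ denotes this Lipschitz constant (a seminorm on $H^1[0,1]$). $H_0^1[0,1]$ is the subspace of $v\in H^1[0,1]$ with $v(0)=v(1)=0$; it is a Banach space with norm $\|\cdot\|$. Under the stated assumptions on $\varphi,\varphi_1,\varphi_2,f$ (in particular $(1+\|\varphi\|)(\|\varphi_1\|+\|\varphi_2\|)<1$), the functional equation has exactly one solution in $H_0^1[0,1]$. $C^m[0,1]$ denotes the $m$-times continuously differentiable functions on $[0,1]$ (one-sided derivatives at the endpoints). *)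

(* Defs.v *)
From mathcomp Require Import all_boot all_order all_algebra.
From mathcomp Require Import all_classical all_reals all_analysis.
Set Implicit Arguments.
Unset Strict Implicit.
Unset Printing Implicit Defensive.
Import Order.TTheory GRing.Theory Num.Theory.
Import numFieldNormedType.Exports.
Local Open Scope classical_set_scope.
Local Open Scope ring_scope.

(* A real function on [0,1] is represented by a total function [R -> R]; every
   notion below depends only on its values on [0,1]. *)

Definition lip_quotients (R : realType) (v : R -> R) : set R :=
  [set q | exists x y : R, [/\ x \in `[0, 1], y \in `[0, 1], x != y &
     q = `|v x - v y| / `|x - y|]].

(* [sup] of an unbounded set is a default value, so this is the Lipschitz
   constant only for [v] in [H1]. *)
Definition lip_norm (R : realType) (v : R -> R) : R := sup (lip_quotients v).

Definition H1 (R : realType) (v : R -> R) : Prop :=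
  {within `[0, 1], continuous v} /\ has_ubound (lip_quotients v).

Definition H10 (R : realType) (v : R -> R) : Prop :=
  [/\ H1 v, v 0 = 0 & v 1 = 0].

(* The difference quotient is taken inside [0,1] only, which gives the
   one-sided derivatives at 0 and at 1. *)
Definition has_derivative01 (R : realType) (v : R -> R) (x d : R) : Prop :=
  (v y - v x) / (y - x) @[y --> within `[0, 1] x^'] --> d.

Fixpoint C01 (R : realType) (m : nat) (v : R -> R) : Prop :=
  match m with
  | 0 => {within `[0, 1], continuous v}
  | k.+1 => exists v' : R -> R,
      (forall x : R, x \in `[0, 1] -> has_derivative01 v x (v' x)) /\ C01 k v'
  end.

Definition solution (R : realType) (phi phi1 phi2 f u : R -> R) : Prop :=
  H10 u /\
  forall x : R, x \in `[0, 1] ->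
    u x = phi x * u (phi1 x) + (1 - phi x) * u (phi2 x) + f x.

(* Main.v *)
(* Write the equation as u = L u + f.  On functions vanishing at 0 and 1, L
   contracts the Lipschitz seminorm by q = (1 + ||phi||)(||phi1|| + ||phi2||),
   so the iterates of v |-> L v + f from 0 converge geometrically in that
   seminorm to the unique solution u.  They are C^1, and C^1 is closed under
   such limits, hence u is C^1.  Differentiating the equation, u' solves
   u' = phi phi1' (u' o phi1) + (1 - phi) phi2' (u' o phi2) + g,
   g = phi' (u o phi1 - u o phi2) + f',
   whose weights have absolute sum at most ||phi1|| + ||phi2|| < 1.  For
   equations of this second kind a bounded solution is as smooth as the
   coefficients: it is a uniform limit of iterates, again a Lipschitz limit when
   the data are C^1, and differentiation yields an equation of the same kind, so
   one inducts on the order.  Each order gained for g then gives one for u. *)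
Require Import Defs.
From mathcomp Require Import all_boot all_order all_algebra.
From mathcomp Require Import all_classical all_reals all_analysis.
From mathcomp Require Import ring lra.
Import Order.TTheory GRing.Theory Num.Theory.
Import numFieldNormedType.Exports.
Local Open Scope classical_set_scope.
Local Open Scope ring_scope.
Set Implicit Arguments.
Unset Strict Implicit.
Unset Printing Implicit Defensive.

(** * Pointwise estimates for continuity and derivatives relative to [0,1] *)

Definition lipschitz01 {R : realType} (K : R) (v : R -> R) : Prop :=
  forall x y : R, x \in `[0, 1] -> y \in `[0, 1] ->
    `|v x - v y| <= K * `|x - y|.

Definition continuous_at01 {R : realType} (v : R -> R) (x : R) : Prop :=
  forall e : R, 0 < e ->
    \forall y \near x, y \in `[0, 1] -> `|v y - v x| <= e.

(** The division-free form lets [y = x] through, so the calculus rules reduce to adding linear error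
    bounds. *)
Definition derivative_at01 {R : realType} (v : R -> R) (x d : R) : Prop :=
  forall e : R, 0 < e ->
    \forall y \near x, y \in `[0, 1] ->
      `|v y - v x - d * (y - x)| <= e * `|y - x|.

Lemma continuous01E {R : realType} (v : R -> R) :
  {within `[0, 1], continuous v} <->
  (forall x, x \in `[0, 1] -> continuous_at01 v x).
Proof.
rewrite subspace_continuousP; split=> H x x01.
  move=> e e0; have /cvgrPdist_le/(_ e e0) := H x x01.
  by rewrite near_withinE; apply: filterS => y Hy /Hy; rewrite distrC.
apply/cvgrPdist_le => e e0; rewrite near_withinE.
by have := H x x01 e e0; apply: filterS => y Hy /Hy; rewrite distrC.
Qed.

Lemma has_derivative01E {R : realType} (v : R -> R) (x d : R) :
  has_derivative01 v x d <-> derivative_at01 v x d.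
Proof.
have quotE y : y != x ->
    `|d - (v y - v x) / (y - x)| = `|v y - v x - d * (y - x)| / `|y - x|.
  move=> yx; have yx0 : y - x != 0 by rewrite subr_eq0.
  by rewrite -normf_div -[LHS]normrN opprB [in RHS]mulrBl mulfK.
rewrite /has_derivative01; split=> [/cvgrPdist_le H e e0|H].
  have := H e e0; rewrite near_withinE near_withinE; apply: filterS => y Hy y01.
  have [->|yx] := eqVneq y x; first by rewrite !subrr mulr0 subr0 normr0 mulr0.
  have := Hy yx y01; rewrite quotE// ler_pdivrMr//.
  by rewrite normr_gt0 subr_eq0.
apply/cvgrPdist_le => e e0; rewrite near_withinE near_withinE.
have := H e e0; apply: filterS => y Hy yx y01.
by rewrite quotE// ler_pdivrMr ?Hy// normr_gt0 subr_eq0.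
Qed.

(** [0,1] has no isolated point: step right from the left half and left from the right half, by at
    most 1/2. Without such a [y], relative derivatives would be neither unique nor bounded. *)
Lemma near01_neq {R : realType} (x : R) (P : R -> Prop) :
  x \in `[0, 1] -> (\forall y \near x, P y) ->
  exists y, [/\ y \in `[0, 1], y != x & P y].
Proof.
rewrite in_itv/= => /andP[x0 x1] /nbhs_ballP[d /= d0 dP].
have m0 : 0 < Num.min (d / 2) (1 / 2) by rewrite lt_min; apply/andP; split; lra.
have md : Num.min (d / 2) (1 / 2) <= d / 2 by rewrite ge_min lexx.
have m1 : Num.min (d / 2) (1 / 2) <= 1 / 2 by rewrite ge_min lexx orbT.
set m := Num.min _ _ in m0 md m1.
have [xh|xh] := lerP x (1 / 2).
  exists (x + m); split.
  - by rewrite in_itv/=; apply/andP; split; lra.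
  - by rewrite -subr_eq0 addrAC subrr add0r gt_eqF.
  - apply: dP; rewrite /ball/= opprD addrA subrr add0r normrN gtr0_norm//; lra.
exists (x - m); split.
- by rewrite in_itv/=; apply/andP; split; lra.
- by rewrite -subr_eq0 addrAC subrr add0r oppr_eq0 gt_eqF.
- apply: dP; rewrite /ball/= opprB addrCA subrr addr0 gtr0_norm//; lra.
Qed.

Lemma derivative_at01_continuous {R : realType} (v : R -> R) (x d : R) :
  derivative_at01 v x d -> continuous_at01 v x.
Proof.
move=> dv e e0; have D0 : 0 < `|d| + 1 by rewrite ltr_wpDl.
apply: filterS2 (dv 1 ltr01) (nbhsx_ballx x (e / (`|d| + 1)) (divr_gt0 e0 D0)).
move=> y /[swap] xy /[apply]; rewrite mul1r => Hy.
have {}xy : `|y - x| * (`|d| + 1) <= e.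
  by rewrite -ler_pdivlMr// distrC; apply: ltW.
rewrite -[v y - v x](subrK (d * (y - x))).
by apply: le_trans (ler_normD _ _) _; rewrite normrM; lra.
Qed.

(** One nearby point where the increment is [d * (y - x)] up to a small error suffices. This turns
    Lipschitz estimates into sup bounds on derivatives. *)
Lemma derivative_at01_le {R : realType} (K : R) (v : R -> R) (x d : R) :
  x \in `[0, 1] -> lipschitz01 K v -> derivative_at01 v x d -> `|d| <= K.
Proof.
move=> x01 Kv dv; apply/ler_addgt0Pr => e e0.
have [y [y01 yx]] := near01_neq x01 (dv e e0).
move=> /(_ y01) dy; have yx0 : 0 < `|y - x| by rewrite normr_gt0 subr_eq0.
rewrite -(ler_pM2r yx0) mulrDl -normrM.
have := Kv y x y01 x01; have := ler_normB (v y - v x) (v y - v x - d * (y - x)).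
rewrite opprB addrCA subrr addr0; lra.
Qed.

Lemma derivative_at01_unique {R : realType} (v : R -> R) (x d d' : R) :
  x \in `[0, 1] -> derivative_at01 v x d -> derivative_at01 v x d' -> d = d'.
Proof.
move=> x01 dv dv'; apply/eqP; rewrite -subr_eq0 -normr_le0.
apply/ler_addgt0Pr => e e0; rewrite add0r.
have e20 : 0 < e / 2 by lra.
have [y [y01 yx [/(_ y01) H1 /(_ y01) H2]]] :=
  near01_neq x01 (filterI (dv _ e20) (dv' _ e20)).
have yx0 : 0 < `|y - x| by rewrite normr_gt0 subr_eq0.
rewrite -(ler_pM2r yx0) -normrM.
have -> : (d - d') * (y - x) =
  (v y - v x - d' * (y - x)) - (v y - v x - d * (y - x)) by ring.
by apply: (le_trans (ler_normB _ _)); lra.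
Qed.

(** * Rules of calculus relative to [0,1] *)

Lemma derivative_at01_cst {R : realType} (c x : R) :
  derivative_at01 (fun=> c) x 0.
Proof.
move=> e e0; near=> y => _.
by rewrite subrr mul0r subr0 normr0 mulr_ge0// ltW.
Unshelve. all: by end_near. Qed.

Lemma derivative_at01D {R : realType} (f g : R -> R) (x df dg : R) :
  derivative_at01 f x df -> derivative_at01 g x dg ->
  derivative_at01 (fun y => f y + g y) x (df + dg).
Proof.
move=> fx gx e e0; have e20 : 0 < e / 2 by lra.
apply: filterS2 (fx _ e20) (gx _ e20) => y /[swap] Hg /[swap] y01.
move=> /(_ y01) Hf; have {}Hg := Hg y01.
have -> : f y + g y - (f x + g x) - (df + dg) * (y - x) =
  (f y - f x - df * (y - x)) + (g y - g x - dg * (y - x)) by ring.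
by apply: (le_trans (ler_normD _ _)); lra.
Qed.

Lemma derivative_at01M {R : realType} (f g : R -> R) (x df dg : R) :
  derivative_at01 f x df -> derivative_at01 g x dg ->
  derivative_at01 (fun y => f y * g y) x (df * g x + f x * dg).
Proof.
move=> fx gx e e0.
(* The summands of [D] are the factors met by the three errors below, each of size [e / D]; the 1
   covers the variation of [f] near [x]. *)
set D := `|f x| + 1 + `|g x| + `|dg|.
have D0 : 0 < D by rewrite /D ltr_wpDr// ltr_wpDr// ltr_wpDl.
have eD0 : 0 < e / D by exact: divr_gt0.
have fc := derivative_at01_continuous fx.
apply: filterS3 (filterI (fc _ ltr01) (fc _ eD0)) (fx _ eD0) (gx _ eD0).
move=> y [/[swap] f2 /[swap] f1] f3 g1 y01.
have {f1}[f1 {}f2 {}f3 {}g1] := And4 (f1 y01) (f2 y01) (f3 y01) (g1 y01).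
have -> : f y * g y - f x * g x - (df * g x + f x * dg) * (y - x) =
  f y * (g y - g x - dg * (y - x)) + g x * (f y - f x - df * (y - x)) +
  (f y - f x) * dg * (y - x) by ring.
apply: (le_trans (ler_normD _ _)).
apply: (le_trans (lerD (ler_normD _ _) (lexx _))).
rewrite !normrM.
have fy : `|f y| <= `|f x| + 1.
  rewrite -[f y](subrK (f x)) addrC; apply: le_trans (ler_normD _ _) _.
  by rewrite lerD2l.
have -> : e * `|y - x| = (`|f x| + 1) * (e / D * `|y - x|) +
  `|g x| * (e / D * `|y - x|) + e / D * `|dg| * `|y - x|.
  by rewrite -{1}[e](divfK (lt0r_neq0 D0)) /D; ring.
apply: lerD; last by rewrite ler_wpM2r// ler_wpM2r.
by apply: lerD; [apply: ler_pM|rewrite ler_wpM2l].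
Qed.

Lemma derivative_at01_comp {R : realType} (v p : R -> R) (x dp dv : R) :
  (forall y, y \in `[0, 1] -> p y \in `[0, 1]) ->
  derivative_at01 p x dp -> derivative_at01 v (p x) dv ->
  derivative_at01 (v \o p) x (dv * dp).
Proof.
move=> p01 px vx e e0.
(* The slope of [p] near [x] is at most the first two summands, which multiply the error of [v]; the
   last one multiplies the error of [p]. *)
set D := `|dp| + 1 + `|dv|.
have D0 : 0 < D by rewrite /D ltr_wpDr// ltr_wpDl.
have eD0 : 0 < e / D by exact: divr_gt0.
have /nbhs_ballP[d /= d0 dP] := vx _ eD0.
have d20 : 0 < d / 2 by lra.
apply: filterS3 (derivative_at01_continuous px d20) (px _ ltr01) (px _ eD0).
move=> y /[swap] p2 /[swap] p3 /[swap] y01.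
have {}p2 := p2 y01; have {}p3 := p3 y01; move=> /(_ y01) p1.
have /dP /(_ (p01 _ y01)) Hv : ball (p x) d (p y).
  by rewrite /ball/= distrC; lra.
have dpy : `|p y - p x| <= (`|dp| + 1) * `|y - x|.
  rewrite -[p y - p x](subrK (dp * (y - x))).
  by apply: le_trans (ler_normD _ _) _; rewrite normrM; lra.
have -> : (v \o p) y - (v \o p) x - dv * dp * (y - x) =
  (v (p y) - v (p x) - dv * (p y - p x)) + dv * (p y - p x - dp * (y - x)).
  by rewrite /=; ring.
apply: le_trans (ler_normD _ _) _; rewrite normrM.
have -> : e * `|y - x| = e / D * ((`|dp| + 1) * `|y - x|) +
  `|dv| * (e / D * `|y - x|).
  by rewrite -{1}[e](divfK (lt0r_neq0 D0)) /D; ring.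
apply: lerD; last by rewrite ler_wpM2l.
by apply: le_trans Hv _; rewrite ler_wpM2l// ltW.
Qed.

Lemma derivative_at01_eq {R : realType} (v w : R -> R) (x d : R) :
  {in `[0, 1], v =1 w} -> x \in `[0, 1] ->
  derivative_at01 v x d -> derivative_at01 w x d.
Proof.
move=> vw x01 dv e /dv; apply: filterS => y Hy y01.
by rewrite -!vw// Hy.
Qed.

Lemma continuous_at01_eq {R : realType} (v w : R -> R) (x : R) :
  {in `[0, 1], v =1 w} -> x \in `[0, 1] ->
  continuous_at01 v x -> continuous_at01 w x.
Proof.
move=> vw x01 cv e /cv; apply: filterS => y Hy y01.
by rewrite -!vw// Hy.
Qed.

Lemma continuous_at01D {R : realType} (f g : R -> R) (x : R) :
  continuous_at01 f x -> continuous_at01 g x ->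
  continuous_at01 (fun y => f y + g y) x.
Proof.
move=> fx gx e e0; have e20 : 0 < e / 2 by lra.
apply: filterS2 (fx _ e20) (gx _ e20) => y /[swap] Hg /[swap] y01.
move=> /(_ y01) Hf; have {}Hg := Hg y01.
rewrite opprD addrACA; apply: (le_trans (ler_normD _ _)); lra.
Qed.

Lemma continuous_at01M {R : realType} (f g : R -> R) (x : R) :
  continuous_at01 f x -> continuous_at01 g x ->
  continuous_at01 (fun y => f y * g y) x.
Proof.
move=> fx gx e e0.
set D := `|f x| + 1 + `|g x|.
have D0 : 0 < D by rewrite /D ltr_wpDr// ltr_wpDl.
have eD0 : 0 < e / D by exact: divr_gt0.
apply: filterS3 (fx _ ltr01) (fx _ eD0) (gx _ eD0).
move=> y f1 f2 g1 y01.
have {f1}[f1 {}f2 {}g1] := And3 (f1 y01) (f2 y01) (g1 y01).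
have -> : f y * g y - f x * g x = f y * (g y - g x) + g x * (f y - f x) by ring.
apply: (le_trans (ler_normD _ _)).
rewrite !normrM.
have fy : `|f y| <= `|f x| + 1.
  rewrite -[f y](subrK (f x)) addrC; apply: le_trans (ler_normD _ _) _.
  by rewrite lerD2l.
have -> : e = (`|f x| + 1) * (e / D) + `|g x| * (e / D).
  by rewrite -{1}[e](divfK (lt0r_neq0 D0)) /D; ring.
by apply: lerD; [apply: ler_pM|rewrite ler_wpM2l].
Qed.

Lemma continuous_at01_comp {R : realType} (v p : R -> R) (x : R) :
  (forall y, y \in `[0, 1] -> p y \in `[0, 1]) ->
  continuous_at01 p x -> continuous_at01 v (p x) -> continuous_at01 (v \o p) x.
Proof.
move=> p01 px vx e e0.
have /nbhs_ballP[d /= d0 dP] := vx _ e0.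
have d20 : 0 < d / 2 by lra.
apply: filterS (px _ d20) => y /[swap] y01 /(_ y01) py.
apply: dP; last exact: p01.
by rewrite /ball/= distrC; lra.
Qed.

(** * Closure properties of the classes C^k on [0,1] *)

Lemma C01SE {R : realType} (k : nat) (v : R -> R) :
  C01 k.+1 v <-> exists v' : R -> R,
    (forall x, x \in `[0, 1] -> derivative_at01 v x (v' x)) /\ C01 k v'.
Proof.
by split=> -[v' [H Cv']]; exists v'; split=> // x /H /has_derivative01E.
Qed.

Lemma C01_continuous {R : realType} (k : nat) (v : R -> R) (x : R) :
  C01 k v -> x \in `[0, 1] -> continuous_at01 v x.
Proof.
case: k => [/continuous01E Cv|k /C01SE[v' [dv _]]] x01; first exact: Cv.
exact: derivative_at01_continuous (dv x x01).
Qed.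

Lemma C01_leS {R : realType} (k : nat) (v : R -> R) : C01 k.+1 v -> C01 k v.
Proof.
elim: k v => [v Cv|k IHk v [v' [dv Cv']]].
  by apply/continuous01E => x; apply: C01_continuous Cv.
by exists v'; split=> //; exact: IHk.
Qed.

Lemma C01_eq {R : realType} (k : nat) (v w : R -> R) :
  {in `[0, 1], v =1 w} -> C01 k v -> C01 k w.
Proof.
move=> vw; case: k => [/continuous01E Cv|k /C01SE[v' [dv Cv']]].
  apply/continuous01E => x x01; exact: continuous_at01_eq (Cv x x01).
apply/C01SE; exists v'; split=> // x x01; exact: derivative_at01_eq (dv x x01).
Qed.

Lemma C01_cst {R : realType} (k : nat) (c : R) : C01 k (fun=> c).
Proof.
elim: k c => [c|k IHk c].
  by apply/continuous01E => x _; apply: derivative_at01_continuous (derivative_at01_cst c x).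
apply/C01SE; exists (fun=> 0); split=> // x _; exact: derivative_at01_cst.
Qed.

Lemma C01D {R : realType} (k : nat) (v w : R -> R) :
  C01 k v -> C01 k w -> C01 k (fun x => v x + w x).
Proof.
elim: k v w => [v w /continuous01E Cv /continuous01E Cw|k IHk v w].
  by apply/continuous01E => x x01; apply: continuous_at01D; auto.
move=> /C01SE[v' [dv Cv']] /C01SE[w' [dw Cw']]; apply/C01SE.
exists (fun x => v' x + w' x); split; last exact: IHk.
by move=> x x01; apply: derivative_at01D; auto.
Qed.

Lemma C01M {R : realType} (k : nat) (v w : R -> R) :
  C01 k v -> C01 k w -> C01 k (fun x => v x * w x).
Proof.
elim: k v w => [v w /continuous01E Cv /continuous01E Cw|k IHk v w Cv Cw].
  by apply/continuous01E => x x01; apply: continuous_at01M; auto.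
have [/C01SE[v' [dv Cv']] /C01SE[w' [dw Cw']]] := (Cv, Cw); apply/C01SE.
exists (fun x => v' x * w x + v x * w' x); split; last first.
  by apply: C01D; apply: IHk => //; exact: C01_leS.
by move=> x x01; apply: derivative_at01M; auto.
Qed.

Lemma C01N {R : realType} (k : nat) (v : R -> R) :
  C01 k v -> C01 k (fun x => - v x).
Proof.
move=> Cv; apply: (C01_eq _ (C01M (C01_cst k (-1)) Cv)) => x _.
by rewrite mulN1r.
Qed.

Lemma C01_comp {R : realType} (k : nat) (v p : R -> R) :
  (forall y, y \in `[0, 1] -> p y \in `[0, 1]) ->
  C01 k v -> C01 k p -> C01 k (v \o p).
Proof.
move=> p01; elim: k v => [v /continuous01E Cv /continuous01E Cp|k IHk v Cv Cp].
  by apply/continuous01E => x x01; apply: continuous_at01_comp; auto.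
have [/C01SE[v' [dv Cv']] /C01SE[p' [dp Cp']]] := (Cv, Cp); apply/C01SE.
exists (fun x => (v' \o p) x * p' x); split; last first.
  by apply: C01M => //; apply: IHk => //; exact: C01_leS.
by move=> x x01; apply: derivative_at01_comp; auto.
Qed.

Lemma C01_bounded {R : realType} (k : nat) (v : R -> R) :
  C01 k v -> exists B : R, forall x, x \in `[0, 1] -> `|v x| <= B.
Proof.
move=> Cv; have {Cv}Cv : {within `[0, 1], continuous v}.
  by apply/continuous01E => x; exact: C01_continuous Cv.
have Cnv : {within `[0, 1], continuous (fun x => `|v x|)}.
  by move=> x; apply: (@cvg_norm _ _ _ (nbhs x)); exact: Cv.
have [c _ cmax] := EVT_max (@ler01 R) Cnv.
by exists `|v c|.
Qed.

(** Mean value theorem, with a bound on the continuous derivative as the constant. *)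
Lemma C01_lipschitz {R : realType} (k : nat) (v : R -> R) :
  C01 k.+1 v -> exists K : R, 0 <= K /\ lipschitz01 K v.
Proof.
move=> Cv; have [v' [dv Cv']] := (C01SE k v).1 Cv.
have [B HB] := C01_bounded Cv'.
have B0 : 0 <= B by apply: le_trans (normr_ge0 (v' 0)) (HB _ _); rewrite bound_itvE.
have lip_lt x y : x \in `[0, 1] -> y \in `[0, 1] -> x < y ->
    `|v y - v x| <= B * `|y - x|.
  rewrite !in_itv/= => /andP[x0 x1] /andP[y0 y1] xy.
  have sub z : z \in `[x, y] -> z \in `[0, 1].
    by rewrite !in_itv/= => /andP[? ?]; apply/andP; split; lra.
  have vder z : z \in `]x, y[ -> is_derive z 1 v (v' z).
    move=> zxy; have z01 : z \in `[0, 1] by apply/sub/subset_itv_oo_cc.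
    (* A whole neighbourhood of an interior point lies in [0,1], so there the relative derivative is
       the two-sided one that [MVT] requires. *)
    have near01 : \forall t \near z, t \in `[0, 1].
      have /near_in_itvoo := zxy; apply: filterS => t txy.
      exact/sub/subset_itv_oo_cc.
    have cvgz : h^-1 *: ((v \o shift z) (h *: 1) - v z) @[h --> 0^'] --> v' z.
      apply/cvgrPdist_le => e e0; rewrite near_withinE.
      have := dv z z01 e e0 => /(filterI near01).
      move=> /nbhs_ballP[d /= d0 dP].
      apply: filterS (nbhsx_ballx (0 : R) d d0) => h h_lt h0.
      have /dP[zh01 /(_ zh01)] : ball z d (h + z).
        by move: h_lt; rewrite /ball/= opprD addrCA subrr addr0 sub0r.
      rewrite addrK /= => Hh.
      rewrite /GRing.scale/= mulr1.
      have -> : v' z - h^-1 * (v (h + z) - v z) =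
          - ((v (h + z) - v z - v' z * h) / h) by field.
      by rewrite normrN normf_div ler_pdivrMr// normr_gt0.
    apply: DeriveDef; first by apply/cvg_ex; exists (v' z).
    exact: cvg_lim cvgz.
  have vc : {within `[x, y], continuous v}.
    apply: (@continuous_subspaceW _ _ `[x, y] `[0, 1]) => [z /=|]; first exact: sub.
    by apply/continuous01E => z z01; exact: C01_continuous Cv z01.
  have [c cxy ->] := MVT xy vder vc.
  rewrite normrM ler_wpM2r// HB//; exact/sub/subset_itv_oo_cc.
exists B; split=> // x y x01 y01.
have [xy|xy|->] := ltgtP x y; last by rewrite !subrr normr0 mulr0.
  by rewrite distrC (distrC x); exact: lip_lt.
exact: lip_lt.
Qed.

(** * Limits at a geometric rate *)

(** Applied to the absolute value of a difference, this proves identities between limits. *)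
Lemma geometric_le0 {R : realType} (r D a : R) :
  0 <= r < 1 -> (forall n, a <= D * r ^+ n) -> a <= 0.
Proof.
move=> /andP[r0 r1] H; have /(@cvg_geometric R D) : `|r| < 1 by rewrite ger0_norm.
move=> cr; rewrite -(cvg_lim _ cr)//; apply: limr_ge; first by apply/cvg_ex; exists 0.
by near=> n; exact: H.
Unshelve. all: by end_near. Qed.

(** Nested intervals: with [D = C / (1 - r)], the intervals of centre [s n] and radius [D * r ^+ n]
    decrease, since the radius shrinks by exactly [C * r ^+ n] at each step. The supremum of the
    left ends lies in all of them. *)
Lemma geometric_limit {R : realType} (r C : R) (s : nat -> R) :
  0 <= r < 1 -> (forall n, `|s n.+1 - s n| <= C * r ^+ n) ->
  exists l, forall n, `|l - s n| <= C / (1 - r) * r ^+ n.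
Proof.
move=> /andP[r0 r1] Hs; have r10 : 0 < 1 - r by rewrite subr_gt0.
set D := C / (1 - r).
have DE : D * (1 - r) = C by rewrite divfK// lt0r_neq0.
have C0 : 0 <= C by have := Hs 0%N; rewrite expr0 mulr1; exact: le_trans.
have D0 : 0 <= D by rewrite divr_ge0// ltW.
have rn n : 0 <= D * r ^+ n by rewrite mulr_ge0// exprn_ge0.
pose a n := s n - D * r ^+ n; pose b n := s n + D * r ^+ n.
have step n : a n <= a n.+1 /\ b n.+1 <= b n.
  have := Hs n; rewrite ler_norml /a /b exprSr -DE => /andP[H1 H2].
  by split; lra.
have a_nd : {homo a : n m / (n <= m)%N >-> n <= m}.
  by apply/nondecreasing_seqP => n; have [] := step n.
have b_ni : {homo b : n m / (n <= m)%N >-> m <= n}.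
  by apply/nonincreasing_seqP => n; have [] := step n.
have ab n m : a n <= b m.
  apply: le_trans (a_nd n (maxn n m) (leq_maxl _ _)) _.
  apply: le_trans (b_ni m (maxn n m) (leq_maxr _ _)).
  by rewrite /a /b; have := rn (maxn n m); lra.
exists (sup (range a)) => n.
have H1 : a n <= sup (range a).
  by apply: ub_le_sup; [exists (b 0%N) => _ [m _ <-]|exists n].
have H2 : sup (range a) <= b n.
  by apply: ge_sup => [|_ [m _ <-] //]; exists (a 0%N), 0%N.
by rewrite ler_norml; move: H1 H2; rewrite /a /b => H1 H2; apply/andP; split; lra.
Qed.

Lemma continuous_at01_uniform_limit {R : realType} (vn : nat -> R -> R)
    (v : R -> R) (r C : R) (x : R) :
  0 <= r < 1 ->
  (forall n y, y \in `[0, 1] -> `|v y - vn n y| <= C * r ^+ n) ->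
  (forall n, continuous_at01 (vn n) x) -> x \in `[0, 1] -> continuous_at01 v x.
Proof.
move=> r01 Hv Cv x01 e e0.
have e40 : 0 < e / 4 by lra.
have [n Hn] : exists n, C * r ^+ n < e / 4.
  apply: contrapT => /forallNP H.
  have : e / 4 <= 0 by apply: (@geometric_le0 _ r C) => // n; rewrite leNgt; exact/negP.
  lra.
apply: filterS (Cv n _ e40) => y /[swap] y01 /(_ y01) Hy.
have -> : v y - v x = (v y - vn n y) + (vn n y - vn n x) - (v x - vn n x) by ring.
apply: le_trans (ler_normB _ _) _; apply: le_trans (lerD (ler_normD _ _) (lexx _)) _.
by have := Hv n y y01; have := Hv n x x01; lra.
Qed.

(* Lipschitz convergence of the [vn] makes their derivatives converge
   uniformly, with no integration. *)
Lemma C1_lipschitz_limit {R : realType} (vn : nat -> R -> R) (v : R -> R)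
    (r C : R) :
  0 <= r < 1 ->
  (forall n, lipschitz01 (C * r ^+ n) (fun x => v x - vn n x)) ->
  (forall n, C01 1 (vn n)) -> C01 1 v.
Proof.
move=> r01 Hv Cvn; have /andP[r0 r1] := r01.
have /choice[dvn Hdvn] : forall n, exists d : R -> R,
    (forall x, x \in `[0, 1] -> derivative_at01 (vn n) x (d x)) /\ C01 0 d.
  by move=> n; exact/C01SE.
have dvn_step n x : x \in `[0, 1] ->
    `|dvn n.+1 x - dvn n x| <= (C * (1 + r)) * r ^+ n.
  (* Comparing both iterates with [v], their difference has Lipschitz constant
     [C * r ^+ n + C * r ^+ n.+1], which bounds its derivative. *)
  move=> x01; pose w y := vn n.+1 y + (-1) * vn n y.
  have dw : derivative_at01 w x (dvn n.+1 x - dvn n x).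
    rewrite (_ : _ - _ = dvn n.+1 x + (0 * vn n x + (-1) * dvn n x)); last by ring.
    apply: derivative_at01D; first by apply (Hdvn _).1.
    apply: derivative_at01M; first exact: derivative_at01_cst.
    by apply (Hdvn _).1.
  apply: derivative_at01_le x01 _ dw => y z y01 z01.
  have -> : w y - w z = (v y - vn n y - (v z - vn n z)) -
    (v y - vn n.+1 y - (v z - vn n.+1 z)) by rewrite /w; ring.
  apply: le_trans (ler_normB _ _) _; apply: le_trans (lerD (Hv _ _ _ y01 z01) (Hv _ _ _ y01 z01)) _.
  by rewrite exprSr le_eqVlt; apply/orP; left; apply/eqP; ring.
have /choice[w Hw] : forall x, exists l, x \in `[0, 1] -> forall n,
    `|l - dvn n x| <= C * (1 + r) / (1 - r) * r ^+ n.
  move=> x; have [x01|] := boolP (x \in `[0, 1]); last by exists 0.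
  have [l Hl] := geometric_limit r01 (fun n => dvn_step n x x01).
  by exists l.
apply/C01SE; exists w; split=> [x x01|]; last first.
  apply/continuous01E => x x01.
  apply: (continuous_at01_uniform_limit r01 (vn := dvn) _ _ x01).
    by move=> n y y01; exact: Hw.
  by move=> n; exact: C01_continuous (Hdvn n).2 x01.
move=> e e0; have e30 : 0 < e / 3 by lra.
set D := C * (1 + r) / (1 - r) in Hw.
have [n [Hn1 Hn2]] : exists n, C * r ^+ n < e / 3 /\ D * r ^+ n < e / 3.
  apply: contrapT => /forallNP H.
  suff : e / 3 <= 0 by lra.
  (* The sum of absolute values dominates both [C] and [D], whatever their signs, so a single index
     serves both bounds. *)
  apply: (@geometric_le0 _ r (`|C| + `|D|)) => // n; rewrite leNgt; apply/negP => Hn.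
  have rn : 0 <= r ^+ n by exact: exprn_ge0.
  by apply: (H n); split; apply: le_lt_trans Hn; rewrite ler_wpM2r//;
    [have := ler_norm C|have := ler_norm D]; have := normr_ge0 C; have := normr_ge0 D; lra.
apply: filterS ((Hdvn n).1 x x01 _ e30) => y /[swap] y01 /(_ y01) Hy.
(* Lipschitz closeness makes the first term at most a small multiple of the distance from [x] to
   [y], which uniform closeness alone would not give. *)
have -> : v y - v x - w x * (y - x) = (v y - vn n y - (v x - vn n x)) +
  (vn n y - vn n x - dvn n x * (y - x)) - (w x - dvn n x) * (y - x) by ring.
apply: le_trans (ler_normB _ _) _; apply: le_trans (lerD (ler_normD _ _) (lexx _)) _.
rewrite normrM; move: (normr_ge0 (y - x)) (Hw x x01 n) (Hv n y x y01 x01) Hy.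
set a := `|y - x| => a0 H1 H2 H3.
have := ler_wpM2r a0 (ltW Hn1); have := ler_wpM2r a0 (ltW Hn2).
by have := ler_wpM2r a0 H1; lra.
Qed.

(** Completeness with rates. The limit is built pointwise; for the Lipschitz rate, [geometric_limit]
    is applied to the increments [vn n x - vn n y], whose limit must be [v x - v y]. *)
Lemma lipschitz_geometric_limit {R : realType} (vn : nat -> R -> R)
    (r B K : R) :
  0 <= r < 1 ->
  (forall n x, x \in `[0, 1] -> `|vn n.+1 x - vn n x| <= B * r ^+ n) ->
  (forall n, lipschitz01 (K * r ^+ n) (fun x => vn n.+1 x - vn n x)) ->
  exists v : R -> R,
    (forall n x, x \in `[0, 1] -> `|v x - vn n x| <= B / (1 - r) * r ^+ n) /\
    (forall n, lipschitz01 (K / (1 - r) * r ^+ n) (fun x => v x - vn n x)).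
Proof.
move=> r01 HB HK.
have /choice[v Hv] : forall x, exists l, x \in `[0, 1] -> forall n,
    `|l - vn n x| <= B / (1 - r) * r ^+ n.
  move=> x; have [x01|] := boolP (x \in `[0, 1]); last by exists 0.
  by have [l Hl] := geometric_limit r01 (fun n => HB n x x01); exists l.
exists v; split=> [n x x01|n x y x01 y01]; first exact: Hv.
have [|l Hl] := @geometric_limit R r (K * `|x - y|) (fun n => vn n x - vn n y) r01.
  move=> k; have := HK k x y x01 y01.
  rewrite (_ : vn k.+1 x - vn k x - (vn k.+1 y - vn k y) =
    vn k.+1 x - vn k.+1 y - (vn k x - vn k y)); last by ring.
  by rewrite mulrAC.
have lE : l = v x - v y.
  apply/eqP; rewrite -subr_eq0 -normr_le0.
  set D := B / (1 - r) in Hv; set E := _ / _ in Hl.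
  apply: (@geometric_le0 _ r (E + D + D)) => // k.
  have -> : l - (v x - v y) =
    (l - (vn k x - vn k y)) - (v x - vn k x) + (v y - vn k y) by ring.
  apply: le_trans (ler_normD _ _) _.
  apply: le_trans (lerD (ler_normB _ _) (lexx _)) _.
  by rewrite !mulrDl !lerD// Hv.
have := Hl n; rewrite lE.
rewrite (_ : v x - vn n x - (v y - vn n y) = v x - v y - (vn n x - vn n y)); last by ring.
by rewrite [K * _ / _]mulrAC [_ * `|x - y| * _]mulrAC.
Qed.

(** * Weighted composition operators and their fixed points *)

Definition wcomp {R : realType} (a1 a2 p1 p2 v : R -> R) (x : R) : R :=
  a1 x * v (p1 x) + a2 x * v (p2 x).

(** Partial sums of the Neumann series of [g]: the [n]-th iterate adds up the first [n] powers of
    the operator applied to [g]. *)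
Definition iterate {R : realType} (a1 a2 p1 p2 g : R -> R) (n : nat) : R -> R :=
  iter n (fun v x => wcomp a1 a2 p1 p2 v x + g x) (fun=> 0).

Section WeightedComposition.
Context {R : realType}.
Variables a1 a2 p1 p2 : R -> R.
Hypothesis p1_01 : forall x, x \in `[0, 1] -> p1 x \in `[0, 1].
Hypothesis p2_01 : forall x, x \in `[0, 1] -> p2 x \in `[0, 1].

Local Notation L := (wcomp a1 a2 p1 p2).
Local Notation vn g := (iterate a1 a2 p1 p2 g).

Lemma wcompB v w x : L (fun y => v y - w y) x = L v x - L w x.
Proof. by rewrite /wcomp; ring. Qed.

Lemma iterate_diff g n x : vn g n.+1 x - vn g n x = iter n L g x.
Proof.
elim: n x => [|n IHn] x; first by rewrite /iterate /wcomp/= !mulr0 !add0r subr0.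
rewrite [vn g n.+2]iterS [vn g n.+1]iterS -/(vn g n.+1) -/(vn g n) /=.
rewrite opprD addrACA subrr addr0 -wcompB.
by congr wcomp; apply/funext => y; exact: IHn.
Qed.

(** By linearity [g] cancels, so the error of the iterates is a power of [L] applied to the fixed
    point. Decay of these powers yields both convergence and uniqueness. *)
Lemma fixpoint_sub_iterate g v n x :
  (forall y, y \in `[0, 1] -> v y = L v y + g y) -> x \in `[0, 1] ->
  v x - vn g n x = iter n L v x.
Proof.
move=> vE; elim: n x => [|n IHn] x x01; first by rewrite subr0.
rewrite [vn g n.+1]iterS -/(vn g n) vE// opprD addrACA subrr addr0 -wcompB.
by rewrite iterS /wcomp !IHn; auto.
Qed.

Lemma wcomp_le q B v : 0 <= B ->
  (forall x, x \in `[0, 1] -> `|a1 x| + `|a2 x| <= q) ->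
  (forall x, x \in `[0, 1] -> `|v x| <= B) ->
  forall x, x \in `[0, 1] -> `|L v x| <= q * B.
Proof.
move=> B0 aq vB x x01; apply: le_trans (ler_normD _ _) _; rewrite !normrM.
apply: le_trans (ler_wpM2r B0 (aq x x01)); rewrite mulrDl.
by apply: lerD; rewrite ler_wpM2l// vB; auto.
Qed.

(** Increments of [v] meet the weights, giving the contracting part [q * M]; increments of the
    weights meet values of [v], giving a term that involves only the sup bound [B]. *)
Lemma wcomp_lipschitz q B A1 A2 M v : 0 <= M ->
  (forall x, x \in `[0, 1] -> `|a1 x| + `|a2 x| <= q) ->
  lipschitz01 1 p1 -> lipschitz01 1 p2 ->
  lipschitz01 A1 a1 -> lipschitz01 A2 a2 ->
  (forall x, x \in `[0, 1] -> `|v x| <= B) -> lipschitz01 M v ->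
  lipschitz01 (q * M + (A1 + A2) * B) (L v).
Proof.
move=> M0 aq p1l p2l a1l a2l vB vl x y x01 y01.
have -> : L v x - L v y =
  a1 x * (v (p1 x) - v (p1 y)) + a2 x * (v (p2 x) - v (p2 y)) +
  ((a1 x - a1 y) * v (p1 y) + (a2 x - a2 y) * v (p2 y)) by rewrite /wcomp; ring.
apply: le_trans (ler_normD _ _) _.
apply: le_trans (lerD (ler_normD _ _) (ler_normD _ _)) _.
rewrite !normrM mulrDl; apply: lerD.
  have vp p : (forall z, z \in `[0, 1] -> p z \in `[0, 1]) ->
      lipschitz01 1 p -> `|v (p x) - v (p y)| <= M * `|x - y|.
    move=> p01 pl; apply: le_trans (vl _ _ (p01 _ x01) (p01 _ y01)) _.
    by rewrite ler_wpM2l// -[leRHS]mul1r pl.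
  apply: (@le_trans _ _ ((`|a1 x| + `|a2 x|) * (M * `|x - y|))).
    by rewrite mulrDl; apply: lerD; rewrite ler_wpM2l// vp.
  by rewrite -[leRHS]mulrA ler_wpM2r ?mulr_ge0// aq.
have -> : (A1 + A2) * B * `|x - y| = A1 * `|x - y| * B + A2 * `|x - y| * B by ring.
by apply: lerD; apply: ler_pM => //; rewrite ?a1l ?a2l ?vB; auto.
Qed.

Lemma C01_wcomp k v : C01 k a1 -> C01 k a2 -> C01 k p1 -> C01 k p2 ->
  C01 k v -> C01 k (L v).
Proof. by move=> *; apply: C01D; apply: C01M => //; exact: (C01_comp _ (v := v)). Qed.

Lemma C01_iterate k g n : C01 k a1 -> C01 k a2 -> C01 k p1 -> C01 k p2 ->
  C01 k g -> C01 k (vn g n).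
Proof.
move=> Ca1 Ca2 Cp1 Cp2 Cg; elim: n => [|n IHn]; first exact: C01_cst.
by rewrite /iterate iterS; apply: C01D => //; exact: C01_wcomp.
Qed.

Lemma contraction_fixpoint_sub q B g v n x : 0 <= q -> 0 <= B ->
  (forall x, x \in `[0, 1] -> `|a1 x| + `|a2 x| <= q) ->
  (forall x, x \in `[0, 1] -> v x = L v x + g x) ->
  (forall x, x \in `[0, 1] -> `|v x| <= B) ->
  x \in `[0, 1] -> `|v x - vn g n x| <= B * q ^+ n.
Proof.
move=> q0 B0 aq vE vB x01; rewrite fixpoint_sub_iterate//.
elim: n x x01 => [x x01|n IHn x x01]; first by rewrite mulr1 vB.
rewrite iterS exprS mulrCA; apply: wcomp_le => //.
by rewrite mulr_ge0// exprn_ge0.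
Qed.

Lemma contraction_fixpoint_C0 q B g v : 0 <= q < 1 -> 
  (forall x, x \in `[0, 1] -> `|a1 x| + `|a2 x| <= q) ->
  (forall x, x \in `[0, 1] -> v x = L v x + g x) ->
  (forall x, x \in `[0, 1] -> `|v x| <= B) ->
  C01 0 a1 -> C01 0 a2 -> C01 0 p1 -> C01 0 p2 -> C01 0 g -> C01 0 v.
Proof.
move=> q01 aq vE vB Ca1 Ca2 Cp1 Cp2 Cg; have /andP[q0 _] := q01.
have B0 : 0 <= B by apply: le_trans (normr_ge0 (v 0)) (vB _ _); rewrite bound_itvE.
apply/continuous01E => x x01.
apply: (continuous_at01_uniform_limit q01 (vn := vn g) (C := B)) => //.
  by move=> n y y01; exact: contraction_fixpoint_sub.
by move=> n; apply: (@C01_continuous _ 0) x01; exact: C01_iterate.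
Qed.

(** [v] is only known to be bounded. The iterates have a Lipschitz limit [w], and they also converge
    uniformly to [v] by the sup-norm contraction, so [w] and [v] agree on [0,1]. *)
Lemma contraction_fixpoint_C1 q B g v : 0 <= q < 1 ->
  (forall x, x \in `[0, 1] -> `|a1 x| + `|a2 x| <= q) ->
  lipschitz01 1 p1 -> lipschitz01 1 p2 ->
  (forall x, x \in `[0, 1] -> v x = L v x + g x) ->
  (forall x, x \in `[0, 1] -> `|v x| <= B) ->
  C01 1 a1 -> C01 1 a2 -> C01 1 p1 -> C01 1 p2 -> C01 1 g -> C01 1 v.
Proof.
move=> /andP[q0 q1] aq p1l p2l vE vB Ca1 Ca2 Cp1 Cp2 Cg.
have B0 : 0 <= B by apply: le_trans (normr_ge0 (v 0)) (vB _ _); rewrite bound_itvE.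
have [A1 [A10 a1l]] := C01_lipschitz Ca1.
have [A2 [A20 a2l]] := C01_lipschitz Ca2.
have [G [G0 gl]] := C01_lipschitz Cg.
have [S gS] := C01_bounded Cg.
have S0 : 0 <= S by apply: le_trans (normr_ge0 (g 0)) (gS _ _); rewrite bound_itvE.
(* The Lipschitz constant of [iter n L g] is only O(n q^n), hence a rate
   [r > q]; [M] is chosen so that [q * M + (A1 + A2) * S <= r * M]. *)
pose r := (1 + q) / 2; have qr : q < r by rewrite /r; lra.
have r1 : r < 1 by rewrite /r; lra.
have r0 : 0 <= r by rewrite /r; lra.
have rq0 : 0 < r - q by rewrite subr_gt0.
pose M := G + (A1 + A2) * S / (r - q).
have MG : G <= M.
  by rewrite lerDl; apply: divr_ge0 (ltW rq0); rewrite mulr_ge0// addr_ge0.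
have M0 := le_trans G0 MG.
have ME : q * M + (A1 + A2) * S <= r * M.
  have -> : (A1 + A2) * S = (M - G) * (r - q).
    by rewrite /M addrAC subrr add0r divfK// lt0r_neq0.
  by have := mulr_ge0 G0 (ltW rq0); lra.
have rn n : 0 <= r ^+ n by exact: exprn_ge0.
have dn_sup n x : x \in `[0, 1] -> `|iter n L g x| <= S * r ^+ n.
  elim: n x => [x x01|n IHn x x01]; first by rewrite mulr1 gS.
  apply: (@le_trans _ _ (q * (S * r ^+ n))); last first.
    by rewrite exprS [leRHS]mulrCA; apply: ler_wpM2r (mulr_ge0 S0 (rn n)) _ _ (ltW qr).
  by apply: wcomp_le => //; rewrite mulr_ge0.
have dn_lip n : lipschitz01 (M * r ^+ n) (iter n L g).
  elim: n => [x y x01 y01|n IHn x y x01 y01].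
    rewrite mulr1; apply: le_trans (gl x y x01 y01) _; rewrite ler_wpM2r//.
  have /wcomp_lipschitz := mulr_ge0 M0 (rn n).
  move=> /(_ _ _ _ _ _ aq p1l p2l a1l a2l (dn_sup n) IHn x y x01 y01) H.
  apply: le_trans H _; rewrite ler_wpM2r//.
  have := ler_wpM2r (rn n) ME; rewrite exprS; lra.
have [|||w [wsup wlip]] := @lipschitz_geometric_limit _ (vn g) r S M.
- by rewrite r0.
- by move=> n x x01; rewrite iterate_diff dn_sup.
- move=> n x y x01 y01; rewrite !iterate_diff; exact: dn_lip.
have wv : {in `[0, 1], w =1 v}.
  move=> x x01; apply/eqP; rewrite -subr_eq0 -normr_le0.
  apply: (@geometric_le0 _ r (S / (1 - r) + B)) => [|n]; first by rewrite r0.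
  have -> : w x - v x = (w x - vn g n x) - (v x - vn g n x) by ring.
  apply: le_trans (ler_normB _ _) _; rewrite mulrDl lerD ?wsup//.
  apply: le_trans (contraction_fixpoint_sub n q0 B0 aq vE vB x01) _.
  by rewrite ler_wpM2l// lerXn2r// ?nnegrE// ltW.
apply: (C01_eq wv); apply: (C1_lipschitz_limit _ wlip); first by rewrite r0.
by move=> n; exact: C01_iterate.
Qed.

(** Product and chain rules, then uniqueness of derivatives. Terms with differentiated weights
    involve [v] rather than its derivative and join the inhomogeneity. *)
Lemma fixpoint_derivative (a1' a2' p1' p2' g g' v v' : R -> R) (x : R) :
  (forall y, y \in `[0, 1] -> v y = L v y + g y) ->
  (forall y, y \in `[0, 1] -> derivative_at01 v y (v' y)) ->
  derivative_at01 a1 x (a1' x) -> derivative_at01 a2 x (a2' x) ->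
  derivative_at01 p1 x (p1' x) -> derivative_at01 p2 x (p2' x) ->
  derivative_at01 g x (g' x) -> x \in `[0, 1] ->
  v' x = wcomp (fun y => a1 y * p1' y) (fun y => a2 y * p2' y) p1 p2 v' x +
    (wcomp a1' a2' p1 p2 v x + g' x).
Proof.
move=> vE dv da1 da2 dp1 dp2 dg x01.
transitivity ((a1' x * v (p1 x) + a1 x * (v' (p1 x) * p1' x)) +
  (a2' x * v (p2 x) + a2 x * (v' (p2 x) * p2' x)) + g' x); last first.
  by rewrite /wcomp; ring.
apply: (derivative_at01_unique x01 (dv x x01)).
apply: (derivative_at01_eq (v := fun y => L v y + g y)) => //.
  by move=> y y01; rewrite -vE.
apply: derivative_at01D => //; apply: derivative_at01D.
  by apply: derivative_at01M => //; apply: (derivative_at01_comp _ (v := v)); auto.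
by apply: derivative_at01M => //; apply: (derivative_at01_comp _ (v := v)); auto.
Qed.

End WeightedComposition.

(** * Regularity of bounded fixed points by induction on the order *)

(** All data are quantified because differentiating the equation changes the weights and [g]; only
    [p1] and [p2] persist. *)
Definition contraction_regularity (R : realType) (k : nat) : Prop :=
  forall (a1 a2 p1 p2 g v : R -> R) (q B : R),
    (forall x, x \in `[0, 1] -> p1 x \in `[0, 1]) ->
    (forall x, x \in `[0, 1] -> p2 x \in `[0, 1]) ->
    0 <= q < 1 ->
    (forall x, x \in `[0, 1] -> `|a1 x| + `|a2 x| <= q) ->
    lipschitz01 1 p1 -> lipschitz01 1 p2 ->
    (forall x, x \in `[0, 1] -> v x = wcomp a1 a2 p1 p2 v x + g x) ->
    (forall x, x \in `[0, 1] -> `|v x| <= B) ->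
    C01 k a1 -> C01 k a2 -> C01 k p1 -> C01 k p2 -> C01 k g -> C01 k v.

(* The weights themselves need not be contractive, only the weights
   [a1 * p1'], [a2 * p2'] of the differentiated equation; the original equation
   has weights [phi] and [1 - phi], whose sum is 1. *)
Lemma fixpoint_C01S (R : realType) (k : nat) (a1 a2 p1 p2 g v : R -> R)
    (q c1 c2 : R) :
  contraction_regularity R k ->
  (forall x, x \in `[0, 1] -> p1 x \in `[0, 1]) ->
  (forall x, x \in `[0, 1] -> p2 x \in `[0, 1]) ->
  0 <= q < 1 -> c1 <= 1 -> c2 <= 1 ->
  (forall x, x \in `[0, 1] -> `|a1 x| * c1 + `|a2 x| * c2 <= q) ->
  lipschitz01 c1 p1 -> lipschitz01 c2 p2 ->
  (forall x, x \in `[0, 1] -> v x = wcomp a1 a2 p1 p2 v x + g x) ->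
  C01 k.+1 a1 -> C01 k.+1 a2 -> C01 k.+1 p1 -> C01 k.+1 p2 -> C01 k.+1 g ->
  C01 1 v -> C01 k v -> C01 k.+1 v.
Proof.
move=> reg p1_01 p2_01 q01 c11 c21 aq p1l p2l vE Ca1 Ca2 Cp1 Cp2 Cg C1v Ckv.
have /C01SE[a1' [da1 Ca1']] := Ca1; have /C01SE[a2' [da2 Ca2']] := Ca2.
have /C01SE[p1' [dp1 Cp1']] := Cp1; have /C01SE[p2' [dp2 Cp2']] := Cp2.
have /C01SE[g' [dg Cg']] := Cg; have /C01SE[v' [dv Cv']] := C1v.
have [B v'B] := C01_bounded Cv'.
apply/C01SE; exists v'; split=> //.
have lip1 c p : c <= 1 -> lipschitz01 c p -> lipschitz01 1 p.
  by move=> cle pl x y x01 y01; apply: le_trans (pl _ _ x01 y01) _; rewrite ler_wpM2r.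
apply: (reg (fun y => a1 y * p1' y) (fun y => a2 y * p2' y) p1 p2
  (fun x => wcomp a1' a2' p1 p2 v x + g' x) v' q B) => //.
(* The derivatives of [p1] and [p2] are at most [c1] and [c2] in absolute value. *)
- move=> x x01; apply: le_trans (aq x x01); rewrite !normrM.
  by apply: lerD; rewrite ler_wpM2l//;
    [apply: (derivative_at01_le x01 p1l)|apply: (derivative_at01_le x01 p2l)]; auto.
- exact: lip1 p1l.
- exact: lip1 p2l.
- by move=> x x01; apply: (fixpoint_derivative p1_01 p2_01 vE dv); auto.
- by apply: C01M => //; exact: C01_leS.
- by apply: C01M => //; exact: C01_leS.
- exact: C01_leS.
- exact: C01_leS.
- by apply: C01D => //; apply: C01_wcomp => //; exact: C01_leS.
Qed.

(** The step is [fixpoint_C01S] with both slopes 1. Its C^1 premise comes from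
    [contraction_fixpoint_C1], its C^k premise from the induction hypothesis for the same
    equation. *)
Lemma contraction_regularityP (R : realType) (k : nat) :
  contraction_regularity R k.
Proof.
elim: k => [|k IHk] a1 a2 p1 p2 g v q B p1_01 p2_01 q01 aq p1l p2l vE vB.
  move=> *; exact: contraction_fixpoint_C0 q01 aq vE vB _ _ _ _ _.
move=> Ca1 Ca2 Cp1 Cp2 Cg.
have C1 w : C01 k.+1 w -> C01 1 w.
  by elim: k {IHk Ca1 Ca2 Cp1 Cp2 Cg} => // k IHk /C01_leS.
apply: (fixpoint_C01S IHk p1_01 p2_01 q01 (lexx 1) (lexx 1) _ p1l p2l vE) => //.
- by move=> x x01; rewrite !mulr1 aq.
- by apply: (contraction_fixpoint_C1 p1_01 p2_01 q01 aq p1l p2l vE vB); exact: C1.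
- by apply: (IHk _ _ _ _ _ _ _ _ p1_01 p2_01 q01 aq p1l p2l vE vB); exact: C01_leS.
Qed.

(** * The Lipschitz seminorm and its contraction under the operator *)

Lemma H1_lipschitz (R : realType) (v : R -> R) :
  H1 v -> 0 <= lip_norm v /\ lipschitz01 (lip_norm v) v.
Proof.
move=> [_ vub].
have Hq x y : x \in `[0, 1] -> y \in `[0, 1] -> x != y ->
    `|v x - v y| / `|x - y| <= lip_norm v.
  by move=> x01 y01 xy; apply: ub_le_sup => //; exists x, y.
split.
  apply: le_trans (Hq 0 1 _ _ _); rewrite ?bound_itvE ?divr_ge0//.
  by rewrite eq_sym oner_eq0.
move=> x y x01 y01; have [->|xy] := eqVneq x y.
  by rewrite !subrr normr0 mulr0.
by rewrite -ler_pdivrMr ?Hq// normr_gt0 subr_eq0.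
Qed.

Lemma lipschitz_H1 (R : realType) (K : R) (v : R -> R) :
  lipschitz01 K v -> H1 v.
Proof.
move=> vl; split.
  apply/continuous01E => x x01 e e0.
  have K0 : 0 < `|K| + 1 by rewrite ltr_wpDl.
  apply: filterS (nbhsx_ballx x (e / (`|K| + 1)) (divr_gt0 e0 K0)).
  move=> y xy y01; apply: le_trans (vl y x y01 x01) _.
  move: xy; rewrite /ball/= distrC ltr_pdivlMr// => /ltW.
  by have := ler_wpM2r (normr_ge0 (y - x)) (ler_norm K);
    have := normr_ge0 (y - x); lra.
exists K => _ [x [y [x01 y01 xy ->]]].
by rewrite ler_pdivrMr ?vl// normr_gt0 subr_eq0.
Qed.

(* [u (phi1 y)] and [u (phi2 y)] are compared through the zeros of [u] at 1
   and 0, which gives the factor [c1 * (1 - y) + c2 * y <= c1 + c2]. *)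
Lemma wcomp_H10_lipschitz (R : realType) (phi p1 p2 u : R -> R)
    (c c1 c2 K : R) :
  (forall x, x \in `[0, 1] -> 0 <= phi x <= 1) ->
  (forall x, x \in `[0, 1] -> p1 x \in `[0, 1]) ->
  (forall x, x \in `[0, 1] -> p2 x \in `[0, 1]) ->
  p1 1 = 1 -> p2 0 = 0 -> 0 <= c -> 0 <= c1 -> 0 <= c2 -> 0 <= K ->
  lipschitz01 c phi -> lipschitz01 c1 p1 -> lipschitz01 c2 p2 ->
  u 0 = 0 -> u 1 = 0 -> lipschitz01 K u ->
  lipschitz01 ((1 + c) * (c1 + c2) * K)
    (wcomp phi (fun x => 1 - phi x) p1 p2 u).
Proof.
move=> phi01 p101 p201 p11 p20 c0 c10 c20 K0 phil p1l p2l u0 u1 ul x y x01 y01.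
have i0 : (0 : R) \in `[0, 1] by rewrite bound_itvE.
have i1 : (1 : R) \in `[0, 1] by rewrite bound_itvE.
set a := `|x - y|; have a0 : 0 <= a by exact: normr_ge0.
have U1 : `|u (p1 x) - u (p1 y)| <= K * (c1 * a).
  by apply: le_trans (ul _ _ (p101 _ x01) (p101 _ y01)) _; rewrite ler_wpM2l// p1l.
have U2 : `|u (p2 x) - u (p2 y)| <= K * (c2 * a).
  by apply: le_trans (ul _ _ (p201 _ x01) (p201 _ y01)) _; rewrite ler_wpM2l// p2l.
have /andP[y0 y1] : 0 <= y <= 1 by move: y01; rewrite in_itv.
have V1 : `|u (p1 y)| <= K * c1.
  rewrite -[u (p1 y)]subr0 -u1; apply: le_trans (ul _ _ (p101 _ y01) i1) _.
  rewrite ler_wpM2l// -{1}p11; apply: le_trans (p1l _ _ y01 i1) _.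
  by rewrite ler_piMr// ler_norml; apply/andP; split; lra.
have V2 : `|u (p2 y)| <= K * c2.
  rewrite -[u (p2 y)]subr0 -u0; apply: le_trans (ul _ _ (p201 _ y01) i0) _.
  rewrite ler_wpM2l// -{1}p20; apply: le_trans (p2l _ _ y01 i0) _.
  by rewrite ler_piMr// subr0 ler_norml; apply/andP; split; lra.
have /andP[f0 f1] := phi01 x x01.
rewrite /wcomp.
(* The first two terms have weights in [0,1] and contribute [c1 + c2]; the increment of [phi]
   contributes [c * (c1 + c2)]. Together they give the factor [1 + c]. *)
have -> : phi x * u (p1 x) + (1 - phi x) * u (p2 x) -
    (phi y * u (p1 y) + (1 - phi y) * u (p2 y)) =
  phi x * (u (p1 x) - u (p1 y)) + (1 - phi x) * (u (p2 x) - u (p2 y)) +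
  (phi x - phi y) * (u (p1 y) - u (p2 y)) by ring.
apply: le_trans (ler_normD _ _) _.
apply: le_trans (lerD (ler_normD _ _) (lexx _)) _.
have -> : (1 + c) * (c1 + c2) * K * a =
  1 * (K * (c1 * a)) + 1 * (K * (c2 * a)) + c * a * (K * c1 + K * c2) by ring.
rewrite !normrM; apply: lerD; last first.
  apply: ler_pM => //; first exact: phil.
  by apply: le_trans (ler_normB _ _) (lerD V1 V2).
by apply: lerD; apply: ler_pM => //; rewrite ger0_norm; lra.
Qed.

(** * Existence, uniqueness and C^m regularity of the solution *)

Theorem proposition1 (R : realType) (phi phi1 phi2 f : R -> R) (m : nat)
    (Hphi : H1 phi) (Hphi1 : H1 phi1) (Hphi2 : H1 phi2) (Hf : H10 f)
    (phi_0 : phi 0 = 0) (phi_1 : phi 1 = 1)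
    (phi1_1 : phi1 1 = 1) (phi2_0 : phi2 0 = 0)
    (phi_range : forall x : R, x \in `[0, 1] -> 0 <= phi x <= 1)
    (phi1_range : forall x : R, x \in `[0, 1] -> 0 <= phi1 x <= 1)
    (phi2_range : forall x : R, x \in `[0, 1] -> 0 <= phi2 x <= 1)
    (m_ge1 : (1 <= m)%N)
    (phi1_Cm : C01 m phi1) (phi2_Cm : C01 m phi2)
    (phi_Cm1 : C01 m.+1 phi) (f_Cm1 : C01 m.+1 f)
    (contraction :
       (1 + lip_norm phi) * (lip_norm phi1 + lip_norm phi2) < 1) :
  exists u : R -> R,
    [/\ solution phi phi1 phi2 f u,
        forall w : R -> R, solution phi phi1 phi2 f w ->
          forall x : R, x \in `[0, 1] -> w x = u x
      & C01 m u].
Proof.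
have p1_01 x : x \in `[0, 1] -> phi1 x \in `[0, 1].
  by move=> x01; rewrite in_itv/= phi1_range.
have p2_01 x : x \in `[0, 1] -> phi2 x \in `[0, 1].
  by move=> x01; rewrite in_itv/= phi2_range.
have i0 : (0 : R) \in `[0, 1] by rewrite bound_itvE.
have i1 : (1 : R) \in `[0, 1] by rewrite bound_itvE.
have [c0 phil] := H1_lipschitz Hphi.
have [c10 p1l] := H1_lipschitz Hphi1.
have [c20 p2l] := H1_lipschitz Hphi2.
case: Hf => Hf1 f0 f1; have [F0 fl] := H1_lipschitz Hf1.
set c := lip_norm phi in contraction c0 phil.
set c1 := lip_norm phi1 in contraction c10 p1l.
set c2 := lip_norm phi2 in contraction c20 p2l.
set F := lip_norm f in F0 fl.
set q := (1 + c) * (c1 + c2) in contraction.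
have q01 : 0 <= q < 1 by rewrite contraction andbT mulr_ge0 ?addr_ge0.
have /andP[q0 _] := q01.
have c12q : c1 + c2 <= q by rewrite /q ler_peMl ?addr_ge0// lerDl.
pose psi x := 1 - phi x.
pose L := wcomp phi psi phi1 phi2.
have L_lip K u : 0 <= K -> u 0 = 0 -> u 1 = 0 -> lipschitz01 K u ->
    lipschitz01 (q * K) (L u).
  by move=> K0; exact: wcomp_H10_lipschitz.
(* [L] keeps both boundary zeros, as [L_lip] needs at every iteration: at 0 only the [phi2] term
   survives, at 1 only the [phi1] term. *)
have L0 u : u 0 = 0 -> L u 0 = 0.
  by move=> u0; rewrite /L /wcomp phi_0 phi2_0 u0 mul0r mulr0 addr0.
have L1 u : u 1 = 0 -> L u 1 = 0.
  by move=> u1; rewrite /L /wcomp /psi phi_1 phi1_1 u1 subrr mul0r mulr0 addr0.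
have iterL K u : 0 <= K -> u 0 = 0 -> u 1 = 0 -> lipschitz01 K u ->
    forall n, [/\ iter n L u 0 = 0, iter n L u 1 = 0 &
      lipschitz01 (K * q ^+ n) (iter n L u)].
  move=> K0 u0 u1 ul; elim=> [|n [IH0 IH1 IHl]]; first by rewrite mulr1.
  split; [exact: L0|exact: L1|].
  by rewrite exprS mulrCA; apply: L_lip => //; rewrite mulr_ge0// exprn_ge0.
(* A zero at 0 makes the Lipschitz constant a sup bound too, so [F] serves for both rates below. *)
have sup_lip (K : R) (u : R -> R) : 0 <= K -> u 0 = 0 -> lipschitz01 K u ->
    forall x, x \in `[0, 1] -> `|u x| <= K.
  move=> K0 u0 ul x x01; have := ul _ _ x01 i0; rewrite u0 !subr0 => /le_trans.
  apply; rewrite ler_piMr//.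
  by move: x01; rewrite in_itv/= => /andP[x0 x1]; rewrite ger0_norm.
have fixE w : solution phi phi1 phi2 f w ->
    forall x, x \in `[0, 1] -> w x = L w x + f x by case.
pose vn := iterate phi psi phi1 phi2 f.
have dn := iterL F f F0 f0 f1 fl.
have [|||u [usup ulip]] := @lipschitz_geometric_limit _ vn q F F.
- exact: q01.
- move=> n x x01; rewrite iterate_diff; have [d0 _ dl] := dn n.
  by apply: sup_lip => //; rewrite mulr_ge0// exprn_ge0.
- by move=> n x y x01 y01; rewrite !iterate_diff; have [_ _] := dn n; exact.
set D := F / (1 - q) in usup ulip.
have D0 : 0 <= D by rewrite divr_ge0// subr_ge0 ltW.
have vn0 n : vn n 0 = 0.
  elim: n => // n IHn; rewrite /vn /iterate iterS f0 addr0; exact: L0.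
have vn1 n : vn n 1 = 0.
  elim: n => // n IHn; rewrite /vn /iterate iterS f1 addr0; exact: L1.
have u0 : u 0 = 0.
  apply/eqP; rewrite -normr_le0; apply: (@geometric_le0 _ q D) => // n.
  by have := usup n 0 i0; rewrite vn0 subr0.
have u1 : u 1 = 0.
  apply/eqP; rewrite -normr_le0; apply: (@geometric_le0 _ q D) => // n.
  by have := usup n 1 i1; rewrite vn1 subr0.
have ul : lipschitz01 D u.
  (* The zeroth iterate is 0, so the rate at index 0 is a Lipschitz bound for [u] itself. *)
  move=> x y x01 y01; have := ulip 0%N x y x01 y01.
  by rewrite mulr1 /vn /iterate/= !subr0.
have u_sol : solution phi phi1 phi2 f u.
  split; first by split=> //; exact: lipschitz_H1 ul.
  move=> x x01; apply/eqP; rewrite -subr_eq0 -normr_le0.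
  apply: (@geometric_le0 _ q (D + D)) => // n.
  (* The recursion of the iterates turns the residual of [u] into two approximation errors, at
     indices [n.+1] and [n]. *)
  have -> : u x - (phi x * u (phi1 x) + (1 - phi x) * u (phi2 x) + f x) =
      (u x - vn n.+1 x) - L (fun y => u y - vn n y) x.
    by rewrite /vn /iterate iterS /L /wcomp /psi; ring.
  have Dn : 0 <= D * q ^+ n by rewrite mulr_ge0// exprn_ge0.
  apply: le_trans (ler_normB _ _) _; rewrite mulrDl; apply: lerD.
    apply: le_trans (usup n.+1 x x01) _; rewrite ler_wpM2l// exprS.
    by rewrite ler_piMl ?exprn_ge0// ltW.
  (* In the sup norm [L] is merely nonexpansive, since its weights sum to 1; the decay comes from
     [u - vn n]. *)
  rewrite -[leRHS]mul1r; apply: (wcomp_le p1_01 p2_01 _ _ _ x01) => // [z z01|z z01].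
    have /andP[z0 z1] := phi_range z z01.
    by rewrite ger0_norm// ger0_norm ?subr_ge0// addrC subrK.
  exact: usup.
exists u; split=> // [w w_sol x x01|].
  have [[w_H1 w0 w1] _] := w_sol; have [W0 wl] := H1_lipschitz w_H1.
  apply/eqP; rewrite -subr_eq0 -normr_le0.
  apply: (@geometric_le0 _ q (lip_norm w + D)) => // n.
  (* The error of [w] is the [n]-th power of [L] applied to [w], which decays because [w] is
     Lipschitz and vanishes at both ends. *)
  have -> : w x - u x = (w x - vn n x) - (u x - vn n x) by ring.
  apply: le_trans (ler_normB _ _) _; rewrite mulrDl lerD ?usup//.
  rewrite (fixpoint_sub_iterate p1_01 p2_01 n (fixE _ w_sol))//.
  have [d0 _ dl] := iterL _ _ W0 w0 w1 wl n.
  by apply: sup_lip => //; rewrite mulr_ge0// exprn_ge0.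
have C_le j k (v : R -> R) : (j <= k)%N -> C01 k v -> C01 j v.
  move=> /subnK <-; elim: (k - j)%N => // i IHi Cv; apply: IHi.
  by apply: C01_leS.
have Cpsi k : C01 k phi -> C01 k psi.
  by move=> Cphi; apply: C01D; [exact: C01_cst|exact: C01N].
have Cphi : C01 m phi := C01_leS phi_Cm1.
have Cf : C01 m f := C01_leS f_Cm1.
(* As [m] is at least 1, all data and hence all iterates are C^1. This starts the bootstrap, since
   [fixpoint_C01S] presupposes a derivative of [u]. *)
have C1u : C01 1 u.
  apply: (C1_lipschitz_limit q01 ulip) => n.
  by apply: C01_iterate => //; (try apply: Cpsi); exact: (C_le _ m).
have Cu j : (j <= m)%N -> C01 j u.
  elim: j => [_|j IHj jm]; first exact: C01_leS.
  apply: (fixpoint_C01S (@contraction_regularityP R j) p1_01 p2_01 q01 (c1 := c1)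
    (c2 := c2) _ _ _ p1l p2l (fixE _ u_sol)) => //; try exact: (C_le _ m).
  - lra.
  - lra.
  (* [phi] and [psi] are at most 1, so the slopes [c1] and [c2] add up to at most [q]. *)
  - move=> x x01; have /andP[z0 z1] := phi_range x x01.
    apply: le_trans c12q; apply: lerD; rewrite ler_piMl//.
      by rewrite ger0_norm.
    by rewrite /psi ger0_norm; lra.
  - by apply: Cpsi; exact: (C_le _ m).
  - exact/IHj/ltnW.
exact: Cu.
Qed.
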